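(* Let $Q$ be an $n$-dimensional manifold, $[a,b]\subset\mathbb{R}$, $0<\alpha\le1$, $0<\beta\le1$, and let $t$ be a real parameter. Let $L:TQ\to\mathbb{R}$ be a Lagrangian of class $C^2$ that is hyperregular, meaning $\det\big(\frac{\partial^2L}{\partial v^i\partial v^j}\big)\neq0$. Let $\gamma_r:Q\to\mathbb{R}$, $r=1,\dots,m$, be deterministic functions of class $C^2$, and let $W^1,\dots,W^m$ be independent real-valued Wiener processes on $[a,b]$. Let $H=p_iv^i-L(q,v)$, regarded as a function of $(q,p)$ through the relation $p_i=\frac{\partial L}{\partial v^i}(q,v)$. Then the system of stochastic equations for $(q,v,p)$, $s\in[a,b]$, $$dq^i=v^i\,ds,$$ $$dp_i=\Big(\frac{\partial L}{\partial q^i}(q,v)+\frac{\partial L}{\partial v^i}(q,v)\,\frac{\alpha-1}{t-s}\Big)ds+\frac{\Gamma(\alpha)}{\Gamma(\beta)}\,\frac{\partial\gamma_r(q)}{\partial q^i}\,(t-s)^{\beta-\alpha}\,dW^r(s),$$ $$p_i=\frac{\partial L}{\partial v^i}(q,v),\qquad i=1,\dots,n,$$ is equivalent to the system (the stochastic fractional Hamiltonian equations) $$dq^i=\frac{\partial H}{\partial p_i}\,ds,$$ $$dp_i=\Big(-\frac{\partial H}{\partial q^i}+\frac{\alpha-1}{t-s}\,p_i\Big)ds+\frac{\Gamma(\alpha)}{\Gamma(\beta)}\,\frac{\partial\gamma_r(q)}{\partial q^i}\,(t-s)^{\beta-\alpha}\,dW^r(s),\qquad i=1,\dots,n.$$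
   Context: Equations are written in local coordinates $(q^i,v^i)$ on $TQ$ and $(q^i,p_i)$ on $T^*Q$, with Itô stochastic differentials. Repeated indices are summed ($i$ over $1,\dots,n$; $r$ over $1,\dots,m$). $\Gamma(\cdot)$ is Euler's gamma function. *)

(* Defs.v *)
From HB Require Import structures.
From mathcomp Require Export all_boot all_order all_algebra.
From mathcomp Require Export all_classical all_reals all_analysis.
Export Order.TTheory GRing.Theory Num.Theory.
Export numFieldNormedType.Exports.

Set Implicit Arguments.
Unset Strict Implicit.
Unset Printing Implicit Defensive.

Local Open Scope classical_set_scope.
Local Open Scope ring_scope.

(** * Differential calculus in coordinates *)

(* C^k on D, through directional derivatives in every direction; for D open in
   a finite-dimensional V this is the usual notion. *)
Fixpoint Ck (R : realType) (k : nat) (V W : normedModType R) (D : set V)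
    (f : V -> W) : Prop :=
  match k with
  | 0 => forall x, D x -> {for x, continuous f}
  | k'.+1 => forall u : V,
      (forall x, D x -> derivable f x u) /\ Ck k' D ('D_u f)
  end.

Definition ebase (R : realType) (n : nat) (k : 'I_n) : 'rV[R]_n := delta_mx 0 k.

(* Partial derivatives of a function of (x, y): in the k-th component of x for
   [partial1], of y for [partial2]. *)
Definition partial1 (R : realType) (n : nat) (k : 'I_n)
    (f : 'rV[R]_n * 'rV[R]_n -> R) : 'rV[R]_n * 'rV[R]_n -> R :=
  'D_(ebase R k, 0) f.

Definition partial2 (R : realType) (n : nat) (k : 'I_n)
    (f : 'rV[R]_n * 'rV[R]_n -> R) : 'rV[R]_n * 'rV[R]_n -> R :=
  'D_(0, ebase R k) f.

(** * Manifolds, tangent and cotangent bundles *)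

Record manifold (R : realType) (n : nat) := Manifold {
  mpoint :> topologicalType;
  chart : Type;
  cdom : chart -> set mpoint;
  cmap : chart -> mpoint -> 'rV[R]_n;
  cinv : chart -> 'rV[R]_n -> mpoint;
  chart_at : mpoint -> chart;
  manifold_hausdorff : hausdorff_space mpoint;
  manifold_countable : @second_countable mpoint;
  cdom_open : forall i, open (cdom i);
  cran_open : forall i, open (cmap i @` cdom i);
  cmap_continuous : forall i x, cdom i x -> {for x, continuous (cmap i)};
  cinv_continuous :
    forall i y, (cmap i @` cdom i) y -> {for y, continuous (cinv i)};
  cmapK : forall i x, cdom i x -> cinv i (cmap i x) = x;
  chart_at_dom : forall x, cdom (chart_at x) x;
  transition_smooth : forall i j k,
    Ck k (cmap i @` (cdom i `&` cdom j)) (cmap j \o cinv i) }.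

Arguments cdom {R n m} i _ : rename.
Arguments cmap {R n m} i _ : rename.
Arguments cinv {R n m} i _ : rename.

Definition cran (R : realType) (n : nat) (Q : manifold R n) (i : chart Q) :
  set 'rV[R]_n := cmap i @` cdom i.

Definition transition (R : realType) (n : nat) (Q : manifold R n)
  (i j : chart Q) : 'rV[R]_n -> 'rV[R]_n := cmap j \o cinv i.

(* T_xQ and T*_xQ are represented by R^n: a (co)vector at x is given by its
   components in the chosen chart [chart_at x].  Its components in another chart
   come from the transformation rules in [tcoord] and [ccoord], so that (x, v)
   has no meaning in coordinates other than through these functions. *)
Definition tangent (R : realType) (n : nat) (Q : manifold R n) : Type :=
  (Q * 'rV[R]_n)%type.

Definition cotangent (R : realType) (n : nat) (Q : manifold R n) : Type :=
  (Q * 'rV[R]_n)%type.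

(* Induced coordinates (q^k, v^k) on TQ and their inverse.  Row convention:
   ['J f x] has (k, l) entry d(f^l)/dx^k, so the differential is v *m 'J f x. *)
Definition tcoord (R : realType) (n : nat) (Q : manifold R n) (i : chart Q)
    (z : tangent Q) : 'rV[R]_n * 'rV[R]_n :=
  let j := chart_at z.1 in
  (cmap i z.1, z.2 *m 'J (transition j i) (cmap j z.1)).

Definition tpoint (R : realType) (n : nat) (Q : manifold R n) (i : chart Q)
    (y : 'rV[R]_n * 'rV[R]_n) : tangent Q :=
  let x : Q := cinv i y.1 in
  (x, y.2 *m 'J (transition i (chart_at x)) y.1).

(* Induced coordinates (q^k, p_k) on T*Q and their inverse. *)
Definition ccoord (R : realType) (n : nat) (Q : manifold R n) (i : chart Q)
    (z : cotangent Q) : 'rV[R]_n * 'rV[R]_n :=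
  (cmap i z.1, z.2 *m ('J (transition i (chart_at z.1)) (cmap i z.1))^T).

Definition cpoint (R : realType) (n : nat) (Q : manifold R n) (i : chart Q)
    (y : 'rV[R]_n * 'rV[R]_n) : cotangent Q :=
  let x : Q := cinv i y.1 in
  let j := chart_at x in
  (x, y.2 *m ('J (transition j i) (cmap j x))^T).

(** * Lagrangian, Legendre relation, Hamiltonian *)

Definition C2_fun (R : realType) (n : nat) (Q : manifold R n) (g : Q -> R) :=
  forall i : chart Q, Ck 2 (cran i) ((g \o cinv i) : 'rV[R]_n -> R^o).

Definition C2_lagrangian (R : realType) (n : nat) (Q : manifold R n)
    (L : tangent Q -> R) :=
  forall i : chart Q,
    Ck 2 (cran i `*` setT) ((L \o tpoint i) : 'rV[R]_n * 'rV[R]_n -> R^o).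

Definition hyperregular (R : realType) (n : nat) (Q : manifold R n)
    (L : tangent Q -> R) :=
  forall (i : chart Q) (q v : 'rV[R]_n), cran i q ->
    \det (\matrix_(k, l) partial2 k (partial2 l (L \o tpoint i)) (q, v)) != 0.

(* (q, v) |-> dL/dv (q, v) *)
Definition momentum (R : realType) (n : nat) (Q : manifold R n)
    (L : tangent Q -> R) (i : chart Q) (y : 'rV[R]_n * 'rV[R]_n) : 'rV[R]_n :=
  \row_k partial2 k (L \o tpoint i) y.

(* p = dL/dv (q, v), for v in T_xQ and p in T*_xQ *)
Definition legendre (R : realType) (n : nat) (Q : manifold R n)
    (L : tangent Q -> R) (x : Q) (v p : 'rV[R]_n) :=
  forall i : chart Q, cdom i x ->
    (ccoord i (x, p)).2 = momentum L i (tcoord i (x, v)).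

(* H = p_k v^k - L(q, v) as a function of (q, p): H is determined exactly on the
   range of the Legendre transform, its value elsewhere being irrelevant. *)
Definition is_hamiltonian (R : realType) (n : nat) (Q : manifold R n)
    (L : tangent Q -> R) (H : cotangent Q -> R) :=
  forall (i : chart Q) (q v : 'rV[R]_n), cran i q ->
    let p := momentum L i (q, v) in
    H (cpoint i (q, p)) = \sum_k p 0 k * v 0 k - L (tpoint i (q, v)).

(** * Stochastic calculus on [a, b] *)

Record filtration (R : realType) (d : measure_display) (Omega : measurableType d)
    (P : probability Omega R) (a b : R) := Filtration {
  filt :> R -> set (set Omega);
  filt_sigma : forall s, a <= s <= b -> sigma_algebra setT (filt s);
  filt_measurable : forall s, a <= s <= b -> filt s `<=` measurable;
  filt_mono : forall s u, a <= s -> s <= u -> u <= b -> filt s `<=` filt u;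
  filt_complete : forall s, a <= s <= b -> forall A, P.-negligible A -> filt s A }.

Definition filt_measurable_fun (R : realType) (d : measure_display)
    (Omega : measurableType d) (P : probability Omega R) (a b : R)
    (F : filtration P a b) (s : R) (X : Omega -> R) :=
  forall B : set R, measurable B -> F s (X @^-1` B).

Definition stopping_time (R : realType) (d : measure_display)
    (Omega : measurableType d) (P : probability Omega R) (a b : R)
    (F : filtration P a b) (tau : Omega -> R) :=
  (forall w, a <= tau w <= b) /\
  (forall s, a <= s <= b -> F s [set w | tau w <= s]).

Definition wiener (R : realType) (d : measure_display)
    (Omega : measurableType d) (P : probability Omega R) (a b : R)
    (F : filtration P a b) (W : R -> Omega -> R) :=
  [/\ \forall w \ae P, W a w = 0,
      \forall w \ae P, {within `[a, b], continuous (fun s => W s w)},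
      forall s, a <= s <= b -> filt_measurable_fun F s (W s)
    & forall s u, a <= s -> s < u -> u <= b ->
        let dW := fun w => W u w - W s w in
        (forall B : set R, measurable B ->
          P (dW @^-1` B) = normal_prob 0 (Num.sqrt (u - s)) B) /\
        (forall (A : set Omega) (B : set R), F s A -> measurable B ->
          (P (A `&` dW @^-1` B) = P A * P (dW @^-1` B))%E)].

(* Mutual independence of the sigma-algebras generated by the processes. *)
Definition independent_processes (R : realType) (d : measure_display)
    (Omega : measurableType d) (P : probability Omega R) (a b : R) (m : nat)
    (W : 'I_m -> R -> Omega -> R) :=
  forall A : 'I_m -> set Omega,
    (forall r, <<s [set E | exists s, exists B : set R,
                     [/\ a <= s <= b, measurable B & E = W r s @^-1` B] ]>> (A r)) ->
    (P (\bigcap_r A r) = \prod_(r < m) P (A r))%E.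

(* sum_(k < N) xi_k 1_]t_k, t_(k+1)] *)
Record simple_process (R : realType) (d : measure_display)
    (Omega : measurableType d) (P : probability Omega R) (a b : R)
    (F : filtration P a b) := SimpleProcess {
  sp_size : nat;
  sp_time : nat -> R;
  sp_val : nat -> Omega -> R;
  sp_range : forall k, a <= sp_time k <= b;
  sp_mono : forall k, sp_time k <= sp_time k.+1;
  sp_bounded : forall k, exists M : R, forall w, `|sp_val k w| <= M;
  sp_adapted : forall k, filt_measurable_fun F (sp_time k) (sp_val k) }.

Definition sp_eval (R : realType) (d : measure_display)
    (Omega : measurableType d) (P : probability Omega R) (a b : R)
    (F : filtration P a b) (X : simple_process F) (s : R) (w : Omega) : R :=
  \sum_(k < sp_size X)
    (if sp_time X k < s <= sp_time X k.+1 then sp_val X k w else 0).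

Definition sp_integral (R : realType) (d : measure_display)
    (Omega : measurableType d) (P : probability Omega R) (a b : R)
    (F : filtration P a b) (W : R -> Omega -> R) (X : simple_process F)
    (w : Omega) : R :=
  \sum_(k < sp_size X)
    sp_val X k w * (W (sp_time X k.+1) w - W (sp_time X k) w).

Definition cvg0_in_probability (R : realType) (d : measure_display)
    (Omega : measurableType d) (P : probability Omega R)
    (Z : nat -> Omega -> \bar R) :=
  forall e : R, 0 < e ->
    (fun k => P [set w | (e%:E <= Z k w)%E]) @ \oo --> (0 : \bar R).

(* J = int_a^b Y dW (Ito), for Y measurable, adapted and almost surely square
   integrable: limit in probability of the integrals of simple processes
   approximating Y in L^2([a, b]) in probability. *)
Definition is_ito_integral (R : realType) (d : measure_display)
    (Omega : measurableType d) (P : probability Omega R) (a b : R)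
    (F : filtration P a b) (W : R -> Omega -> R)
    (Y : R -> Omega -> R) (J : Omega -> R) :=
  [/\ measurable_fun [set: measurableTypeR R * Omega] (fun z => Y z.1 z.2),
      forall s, a <= s <= b -> filt_measurable_fun F s (Y s),
      \forall w \ae P,
        (\int[lebesgue_measure]_(s in `[a, b]) ((Y s w) ^+ 2)%:E < +oo)%E,
      measurable_fun [set: Omega] J
    & exists X : nat -> simple_process F,
        cvg0_in_probability P (fun k w =>
          \int[lebesgue_measure]_(s in `[a, b])
             ((sp_eval (X k) s w - Y s w) ^+ 2)%:E)%E /\
        cvg0_in_probability P (fun k w => `|sp_integral W (X k) w - J w|%:E)].

(* d(X) = mu ds + sum_r nu_r dW^r on the stochastic interval [sigma, tau] *)
Definition ito_equation (R : realType) (d : measure_display)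
    (Omega : measurableType d) (P : probability Omega R) (a b : R)
    (F : filtration P a b) (m : nat) (W : 'I_m -> R -> Omega -> R)
    (sigma tau : Omega -> R) (X mu : R -> Omega -> R)
    (nu : 'I_m -> R -> Omega -> R) :=
  exists J : 'I_m -> Omega -> R,
    (forall r, is_ito_integral F (W r)
       (fun s w => if sigma w < s <= tau w then nu r s w else 0) (J r)) /\
    (\forall w \ae P, sigma w < tau w ->
       lebesgue_measure.-integrable `[sigma w, tau w] (fun s => (mu s w)%:E) /\
       X (tau w) w - X (sigma w) w =
         (\int[lebesgue_measure]_(s in `[sigma w, tau w]) mu s w)%R
         + \sum_r J r w).

(* d(X) = mu ds on the stochastic interval [sigma, tau] *)
Definition drift_equation (R : realType) (d : measure_display)
    (Omega : measurableType d) (P : probability Omega R)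
    (sigma tau : Omega -> R) (X mu : R -> Omega -> R) :=
  \forall w \ae P, sigma w < tau w ->
    lebesgue_measure.-integrable `[sigma w, tau w] (fun s => (mu s w)%:E) /\
    X (tau w) w - X (sigma w) w =
      (\int[lebesgue_measure]_(s in `[sigma w, tau w]) mu s w)%R.

(** * The two systems *)

(* Processes with values in TQ (coord = tcoord) or T*Q (coord = ccoord). *)
Definition continuous_adapted (R : realType) (d : measure_display)
    (Omega : measurableType d) (P : probability Omega R) (a b : R)
    (F : filtration P a b) (n : nat) (Q : manifold R n)
    (coord : chart Q -> Q * 'rV[R]_n -> 'rV[R]_n * 'rV[R]_n)
    (q : R -> Omega -> Q) (y : R -> Omega -> 'rV[R]_n) :=
  [/\ \forall w \ae P, {within `[a, b], continuous (fun s => q s w)},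
      \forall w \ae P, forall (i : chart Q) s, a <= s <= b -> cdom i (q s w) ->
        (fun u => coord i (q u w, y u w)) @ within `[a, b] (nbhs s)
          --> coord i (q s w, y s w)
    & forall s, a <= s <= b -> forall (i : chart Q) (O : set ('rV[R]_n * 'rV[R]_n)),
        open O -> F s [set w | cdom i (q s w) /\ O (coord i (q s w, y s w))]].

Definition Gamma (R : realType) (x : R) : R :=
  (\int[lebesgue_measure]_(u in `]0, +oo[) (u `^ (x - 1) * expR (- u)))%R.

(* sigma <= tau are stopping times between which q stays in the chart i.  The
   local equations of a system are required on all such intervals, for every
   chart; by exhaustion this determines the motion on the whole of [a, b]. *)
Definition chart_interval (R : realType) (d : measure_display)
    (Omega : measurableType d) (P : probability Omega R) (a b : R)
    (F : filtration P a b) (n : nat) (Q : manifold R n) (q : R -> Omega -> Q)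
    (i : chart Q) (sigma tau : Omega -> R) :=
  [/\ stopping_time F sigma, stopping_time F tau,
      forall w, sigma w <= tau w
    & \forall w \ae P, sigma w < tau w ->
        forall s, sigma w <= s <= tau w -> cdom i (q s w)].

(* Gamma(alpha)/Gamma(beta) dgamma/dq^k (q) (t - s)^(beta - alpha) *)
Definition noise (R : realType) (n : nat) (Q : manifold R n)
    (alpha beta t : R) (g : Q -> R) (i : chart Q) (k : 'I_n) (s : R) (x : Q) : R :=
  Gamma alpha / Gamma beta * 'D_(ebase R k) (g \o cinv i : _ -> R^o) (cmap i x)
  * (t - s) `^ (beta - alpha).

Definition lagrangian_system (R : realType) (n m : nat) (Q : manifold R n)
    (a b alpha beta t : R) (d : measure_display) (Omega : measurableType d)
    (P : probability Omega R) (F : filtration P a b)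
    (W : 'I_m -> R -> Omega -> R) (L : tangent Q -> R) (gamma : 'I_m -> Q -> R)
    (q : R -> Omega -> Q) (v p : R -> Omega -> 'rV[R]_n) :=
  [/\ continuous_adapted F (@tcoord R n Q) q v,
      continuous_adapted F (@ccoord R n Q) q p,
      forall (i : chart Q) sigma tau, chart_interval F q i sigma tau ->
        forall k : 'I_n,
        drift_equation P sigma tau
          (fun s w => cmap i (q s w) 0 k)
          (fun s w => (tcoord i (q s w, v s w)).2 0 k),
      forall (i : chart Q) sigma tau, chart_interval F q i sigma tau ->
        forall k : 'I_n,
        ito_equation F W sigma tau
          (fun s w => (ccoord i (q s w, p s w)).2 0 k)
          (fun s w => let z := tcoord i (q s w, v s w) in
             partial1 k (L \o tpoint i) z
             + partial2 k (L \o tpoint i) z * ((alpha - 1) / (t - s)))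
          (fun r s w => noise alpha beta t (gamma r) i k s (q s w))
    & \forall w \ae P, forall s, a <= s <= b ->
        legendre L (q s w) (v s w) (p s w)].

(* The first almost sure condition says that (q, p) stays in the domain of H,
   i.e. in the range of the Legendre transform (all of T*Q if the latter is
   onto). *)
Definition hamiltonian_system (R : realType) (n m : nat) (Q : manifold R n)
    (a b alpha beta t : R) (d : measure_display) (Omega : measurableType d)
    (P : probability Omega R) (F : filtration P a b)
    (W : 'I_m -> R -> Omega -> R) (L : tangent Q -> R) (H : cotangent Q -> R)
    (gamma : 'I_m -> Q -> R)
    (q : R -> Omega -> Q) (p : R -> Omega -> 'rV[R]_n) :=
  [/\ continuous_adapted F (@ccoord R n Q) q p,
      \forall w \ae P, forall s, a <= s <= b ->
        exists v, legendre L (q s w) v (p s w),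
      forall (i : chart Q) sigma tau, chart_interval F q i sigma tau ->
        forall k : 'I_n,
        drift_equation P sigma tau
          (fun s w => cmap i (q s w) 0 k)
          (fun s w => partial2 k (H \o cpoint i) (ccoord i (q s w, p s w)))
    & forall (i : chart Q) sigma tau, chart_interval F q i sigma tau ->
        forall k : 'I_n,
        ito_equation F W sigma tau
          (fun s w => (ccoord i (q s w, p s w)).2 0 k)
          (fun s w => let z := ccoord i (q s w, p s w) in
             - partial1 k (H \o cpoint i) z + (alpha - 1) / (t - s) * z.2 0 k)
          (fun r s w => noise alpha beta t (gamma r) i k s (q s w))].

(* Main.v *)
Require Import Defs.
From HB Require Import structures.
From mathcomp Require Import ring lra.
Set Implicit Arguments.
Unset Strict Implicit.
Unset Printing Implicit Defensive.
Local Open Scope classical_set_scope.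
Local Open Scope ring_scope.

(** The two systems have the same noise and the same unknown [q], so they agree
as soon as the velocity can be eliminated and the drifts match.  This is the
classical Legendre duality: if p = dL/dv (q, v), then
  dH/dp (q, p) = v  and  dH/dq (q, p) = - dL/dq (q, v),
which turns either drift into the other along the relation p = dL/dv (almost
surely, on every stochastic interval spent in one chart).

The work lies in the duality, because H is only prescribed on the range of the
Legendre transform (q, v) |-> (q, dL/dv (q, v)), and because hyperregularity is
only the pointwise condition det (d2L/dv2) <> 0.  The derivative of H makes
sense at all because that range is open.  More precisely, invertibility of the
Hessian and a contraction argument ([legendre_solvable]) show that dL/dv
(q, v) = p can be solved near (q0, v0) by some v with
|v - v0| <= K |p - dL/dv (q, v0)|.  This bound is enough: in
H(q, p) = p.v - L(q, v) the first-order variation of v is multiplied by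
p0 - dL/dv (q0, v0) = 0, and the Lipschitz bound makes the remainder negligible,
so H can be differentiated ([hamiltonian_derive]).

Global injectivity of the Legendre transform then comes for free: v is
recovered as dH/dp (q, p), a quantity that depends on (q, p) only
([fiber_deriv_inj]); it is the existence of H as a function of (q, p) that
encodes it.  Being injective and open, the Legendre transform has a continuous
inverse, which is what is needed in order that the velocity read off from a
solution (q, p) of the Hamiltonian equations be a continuous adapted process
([velocity_continuous_adapted]). *)

(** * Strict differentiability of C^1 functions *)

Lemma line_is_derive (R : realType) (V W : normedModType R) (f : V -> W)
    (y u : V) (s : R) :
  derivable f (y + s *: u) u ->
  is_derive s 1 (fun r : R => f (y + r *: u)) ('D_u f (y + s *: u)).
Proof.
have quotE : (fun h : R => h^-1 *: (((fun r : R => f (y + r *: u)) \o shift s)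
      (h *: 1) - f (y + s *: u)))
    = (fun h => h^-1 *: ((f \o shift (y + s *: u)) (h *: u) - f (y + s *: u))).
  by apply/funext => h /=; rewrite [h *: 1]mulr1 scalerDl addrCA.
by move=> df; split; rewrite /derivable /derive quotE.
Qed.

Lemma line_mean_value (R : realType) (V : normedModType R) (f : V -> R^o)
    (y u : V) (c : R) :
  (forall s : R, `|s| <= `|c| -> derivable f (y + s *: u) u) ->
  exists2 s : R, `|s| <= `|c| &
    f (y + c *: u) - f y = c * 'D_u f (y + s *: u).
Proof.
move=> df; pose g (r : R) : R^o := f (y + r *: u).
pose dg (r : R) : R := 'D_u f (y + r *: u).
have gd (s : R) : `|s| <= `|c| -> is_derive s 1 g (dg s).
  by move=> sc; apply: line_is_derive; apply: df.
have g0 : g 0 = f y by rewrite /g scale0r addr0.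
have [c0|c0] := leP 0 c.
  have sc (s : R) : s \in `[0, c] -> `|s| <= `|c|.
    by rewrite in_itv /= => /andP[s0 sc]; rewrite !ger0_norm.
  have [|||s s0c] := @MVT_segment R g dg 0 c.
  - by [].
  - by move=> s /subset_itv_oo_cc s0c; apply: gd; apply: sc.
  - by apply: derivable_within_continuous => s /sc /gd [].
  - rewrite g0 subr0 mulrC => gE; exists s => //; exact: sc.
have sc (s : R) : s \in `[c, 0] -> `|s| <= `|c|.
  rewrite in_itv /= => /andP[cs s0]; rewrite !ler0_norm ?lerN2 //; exact: ltW.
have [|||s sc0] := @MVT_segment R g dg c 0.
- exact: ltW.
- by move=> s /subset_itv_oo_cc s0c; apply: gd; apply: sc.
- by apply: derivable_within_continuous => s /sc /gd [].
- rewrite g0 sub0r mulrN mulrC => gE; exists s; first exact: sc.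
  by rewrite -/(dg s) -/(g c) -[LHS]opprB gE opprK.
Qed.

(** By the mean value theorem the increment is c times the derivative at a point
of the segment; closeness of that point to [x] gives the bound.  The base point
[y] is allowed to move, so that increments along several directions can be
chained. *)
Lemma strict_partial (R : realType) (V : normedModType R) (f : V -> R^o)
    (x u : V) :
  (\forall y \near x, derivable f y u) -> {for x, continuous ('D_u f)} ->
  forall e : R, 0 < e -> exists2 r : R, 0 < r &
    forall (y : V) (c : R), `|y - x| < r -> `|c| < r ->
      `|f (y + c *: u) - f y - c * 'D_u f x| <= e * `|c|.
Proof.
move=> df dfx e e0.
have : \forall y \near x, derivable f y u /\ `|'D_u f x - 'D_u f y| <= e.
  apply/near_andP; split=> //.
  by move: dfx => /cvgrPdist_le /(_ e e0).
move=> /nbhs_normP [r /= r0 rP].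
have u1 : 0 < 1 + `|u| by rewrite ltr_pwDl.
pose rho := r / (1 + `|u|).
have rho0 : 0 < rho by exact: divr_gt0.
exists rho => // y c yx cr.
have near_seg (s : R) : `|s| <= `|c| -> `|x - (y + s *: u)| < r.
  move=> sc; rewrite distrC addrAC; apply: le_lt_trans (ler_normD _ _) _.
  have -> : r = rho + rho * `|u|.
    by rewrite /rho -[X in X + _]mulr1 -mulrDr divfK // gt_eqF.
  rewrite normrZ; apply: ltr_leD => //; apply: ler_wpM2r => //.
  exact: le_trans sc (ltW cr).
have [s sc|s sc ->] := @line_mean_value R V f y u c.
  by have [] := rP _ (near_seg s sc).
rewrite -mulrBr normrM mulrC; apply: ler_wpM2r => //.
by rewrite distrC; have [] := rP _ (near_seg s sc).
Qed.

(** The increments along the directions [u j] are added one after the other, each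
starting from the endpoint reached so far: this is where the freedom of the base
point in [strict_partial] is used. *)
Lemma strict_combination (R : realType) (V : normedModType R) (f : V -> R^o)
    (x : V) (I : Type) (u : I -> V) :
  (forall j, \forall y \near x, derivable f y (u j)) ->
  (forall j, {for x, continuous ('D_(u j) f)}) ->
  forall (js : seq I) (e : R), 0 < e -> exists2 r : R, 0 < r &
    forall (y : V) (c : I -> R), `|y - x| < r -> (forall j, `|c j| < r) ->
      `|f (y + \sum_(j <- js) c j *: u j) - f y
        - \sum_(j <- js) c j * 'D_(u j) f x| <= e * \sum_(j <- js) `|c j|.
Proof.
move=> df dfx js e e0; elim: js => [|j js [r1 r10 r1P]].
  by exists 1 => // y c _ _; rewrite !big_nil addr0 !subrr normr0 mulr0.
have [r2 r20 r2P] := strict_partial (df j) (dfx j) e0.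
pose S := \sum_(i <- js) `|u i|.
have S0 : 0 <= S by apply: sumr_ge0.
have S1 : 0 < 1 + S by rewrite ltr_pwDl.
pose rho := r2 / (1 + S).
have rho0 : 0 < rho by exact: divr_gt0.
exists (Num.min r1 rho); first by rewrite lt_min r10.
move=> y c; rewrite lt_min => /andP[y1 y2] cr.
have c1 i : `|c i| < r1 by have := cr i; rewrite lt_min => /andP[].
have c2 i : `|c i| < rho by have := cr i; rewrite lt_min => /andP[].
pose z := y + \sum_(i <- js) c i *: u i.
have zr : `|z - x| < r2.
  rewrite /z addrAC; apply: le_lt_trans (ler_normD _ _) _.
  have -> : r2 = rho + rho * S.
    by rewrite /rho -[X in X + _]mulr1 -mulrDr divfK // gt_eqF.
  apply: ltr_leD => //; apply: le_trans (ler_norm_sum _ _ _) _.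
  rewrite mulr_sumr; apply: ler_sum => i _; rewrite normrZ.
  by apply: ler_wpM2r => //; exact: ltW.
have cj : `|c j| < r2.
  apply: lt_le_trans (c2 j) _; rewrite ler_pdivrMr // mulrDr mulr1.
  by rewrite lerDl mulr_ge0 // ltW.
rewrite !big_cons.
have -> : y + (c j *: u j + \sum_(i <- js) c i *: u i) = z + c j *: u j.
  by rewrite /z -addrA [c j *: _ + _]addrC.
have := r2P z (c j) zr cj; have := r1P y c y1 c1; rewrite -/z.
set A := f (z + _); set B := f z; set C := f y.
set D := c j * _; set G := \sum_(i <- js) _.
set N := \sum_(i <- js) _ => h1 h2.
have splitE : A - C - (D + G) = (A - B - D) + (B - C - G) by lra.
rewrite [X in `|X|]splitE mulrDr; apply: le_trans (ler_normD _ _) _.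
exact: lerD.
Qed.

Lemma mx_coord_le (R : realType) (m n : nat) (A : 'M[R]_(m, n)) i j :
  `|A i j| <= `|A|.
Proof.
rewrite [leRHS]/Num.Def.normr /= mx_normrE.
by apply/bigmax_geP; right; exists (i, j).
Qed.

Lemma mx_norm_le (R : realType) (m n : nat) (A : 'M[R]_(m, n)) (c : R) :
  0 <= c -> (forall i j, `|A i j| <= c) -> `|A| <= c.
Proof.
move=> c0 Ac; rewrite [leLHS]/Num.Def.normr /= mx_normrE.
by apply: bigmax_le => // -[i j] _; exact: Ac.
Qed.

Lemma pair_norm_lt (R : realType) (U V : normedModType R) (x : U * V) (r : R) :
  (`|x| < r) = (`|x.1| < r) && (`|x.2| < r).
Proof.
by rewrite [X in X < _]/Num.Def.normr /= /ProdNormedZmodule.norm gt_max.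
Qed.

Lemma pair_norm_le (R : realType) (U V : normedModType R) (x : U * V) (r : R) :
  (`|x| <= r) = (`|x.1| <= r) && (`|x.2| <= r).
Proof.
by rewrite [X in X <= _]/Num.Def.normr /= /ProdNormedZmodule.norm ge_max.
Qed.

(** The differential of [f] at [x], applied to the increment [h]. *)
Definition coord_diff (R : realType) (n : nat)
    (f : 'rV[R]_n * 'rV[R]_n -> R) (x h : 'rV[R]_n * 'rV[R]_n) : R :=
  \sum_k h.1 0 k * partial1 k f x + \sum_k h.2 0 k * partial2 k f x.

Lemma pair_sum_ebase (R : realType) (n : nat) (h : 'rV[R]_n * 'rV[R]_n) :
  h = \sum_k h.1 0 k *: (ebase R k, 0) + \sum_k h.2 0 k *: (0, ebase R k).
Proof.
have fst_sum (I : finType) (F : I -> 'rV[R]_n * 'rV[R]_n) :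
  (\sum_i F i).1 = \sum_i (F i).1 by apply: big_morph.
have snd_sum (I : finType) (F : I -> 'rV[R]_n * 'rV[R]_n) :
  (\sum_i F i).2 = \sum_i (F i).2 by apply: big_morph.
case: h => h1 h2 /=; congr pair.
  rewrite /= !fst_sum /= [X in _ + X]big1 ?addr0.
    exact: row_sum_delta.
  by move=> i _; rewrite scaler0.
rewrite /= !snd_sum /= [X in X + _]big1 ?add0r.
  exact: row_sum_delta.
by move=> i _; rewrite scaler0.
Qed.

(** Applied to the 2n coordinate directions, [strict_combination] yields strict
(two-point) differentiability, which is stronger than differentiability at [x]
and is the form that contraction arguments use. *)
Lemma C1_strict_differentiable (R : realType) (n : nat)
    (D : set ('rV[R]_n * 'rV[R]_n)) (f : 'rV[R]_n * 'rV[R]_n -> R)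
    (x : 'rV[R]_n * 'rV[R]_n) :
  open D -> Ck 1 D (f : _ -> R^o) -> D x ->
  forall e : R, 0 < e -> exists2 r : R, 0 < r & forall y z,
    `|y - x| < r -> `|z - x| < r ->
    `|f z - f y - coord_diff f x (z - y)| <= e * `|z - y|.
Proof.
move=> oD fC Dx e e0.
pose u (j : 'I_n + 'I_n) : 'rV[R]_n * 'rV[R]_n :=
  match j with inl k => (ebase R k, 0) | inr k => (0, ebase R k) end.
pose c (h : 'rV[R]_n * 'rV[R]_n) (j : 'I_n + 'I_n) : R :=
  match j with inl k => h.1 0 k | inr k => h.2 0 k end.
have cle h j : `|c h j| <= `|h|.
  have /andP[h1 h2] : (`|h.1| <= `|h|) && (`|h.2| <= `|h|).
    by rewrite -pair_norm_le.
  by case: j => k; apply: le_trans (mx_coord_le _ _ _) _.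
pose N : R := (n + n)%:R.
have N1 : 0 < 1 + N by rewrite ltr_pwDl.
have [|||r r0 rP] := @strict_combination R _ (f : _ -> R^o) x _ u _ _
    (index_enum ('I_n + 'I_n)%type) (e / (1 + N)) _.
- move=> j; have [df _] := fC (u j).
  by apply: filterS df _; apply: open_nbhs_nbhs; split.
- by move=> j; have [_] := fC (u j); apply.
- exact: divr_gt0.
(* Half the radius, so that the increment z - y, hence each of its coordinates,
   is smaller than r. *)
exists (r / 2); first exact: divr_gt0.
move=> y z yr zr.
have zyr : `|z - y| < r.
  rewrite (splitr r); apply: le_lt_trans (ler_distD x _ _) _.
  by rewrite [`|x - y|]distrC ltrD.
have yr' : `|y - x| < r.
  by apply: lt_trans yr _; rewrite gtr_pMr // invf_lt1 // ltr1n.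
have := rP y (c (z - y)) yr' (fun j => le_lt_trans (cle _ j) zyr).
rewrite !big_sumType /= -/(coord_diff f x (z - y)).
rewrite [X in f (y + X)](esym (pair_sum_ebase (z - y))) subrKC.
move=> /le_trans; apply; rewrite -mulrA ler_pM2l // ler_pdivrMl //.
rewrite mulrDl mul1r; apply: ler_wpDl => //.
have sumc (F : 'I_n -> 'I_n + 'I_n) :
    \sum_k `|c (z - y) (F k)| <= n%:R * `|z - y|.
  apply: (@le_trans _ _ (\sum_(k < n) `|z - y|)); first by apply: ler_sum.
  by rewrite sumr_const card_ord mulr_natl.
rewrite /N natrD mulrDl; apply: lerD; [exact: (sumc inl)|exact: (sumc inr)].
Qed.

Lemma coord_diff_bound (R : realType) (n : nat)
    (f : 'rV[R]_n * 'rV[R]_n -> R) (x : 'rV[R]_n * 'rV[R]_n) :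
  exists2 C : R, 0 <= C & forall h, `|coord_diff f x h| <= C * `|h|.
Proof.
pose C := \sum_k `|partial1 k f x| + \sum_k `|partial2 k f x|.
exists C; first by apply: addr_ge0; apply: sumr_ge0.
move=> h; have /andP[h1 h2] : (`|h.1| <= `|h|) && (`|h.2| <= `|h|).
  by rewrite -pair_norm_le.
have sum_bound (w : 'rV[R]_n) (g : 'I_n -> R) : `|w| <= `|h| ->
    `|\sum_k w 0 k * g k| <= (\sum_k `|g k|) * `|h|.
  move=> wh; apply: le_trans (ler_norm_sum _ _ _) _; rewrite mulr_suml.
  apply: ler_sum => k _; rewrite normrM mulrC; apply: ler_wpM2l => //.
  exact: le_trans (mx_coord_le _ _ _) wh.
apply: le_trans (ler_normD _ _) _; rewrite mulrDl.
by apply: lerD; apply: sum_bound.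
Qed.

Lemma C1_locally_lipschitz (R : realType) (n : nat)
    (D : set ('rV[R]_n * 'rV[R]_n)) (f : 'rV[R]_n * 'rV[R]_n -> R)
    (x : 'rV[R]_n * 'rV[R]_n) :
  open D -> Ck 1 D (f : _ -> R^o) -> D x ->
  exists2 C : R, 0 < C & \forall y \near x, `|f y - f x| <= C * `|y - x|.
Proof.
move=> oD fC Dx; have [C C0 CP] := coord_diff_bound f x.
have [r r0 rP] := C1_strict_differentiable oD fC Dx ltr01.
exists (1 + C); first by rewrite ltr_pwDl.
apply/nbhs_normP; exists r => //= y; rewrite /ball_ /= distrC => yr.
have := rP x y; rewrite subrr normr0 => /(_ r0 yr) fxy.
rewrite -(subrK (coord_diff f x (y - x)) (f y - f x)).
apply: le_trans (ler_normD _ _) _.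
by rewrite mulrDl; apply: lerD.
Qed.

(** C^1 is phrased through the continuity of directional derivatives alone;
continuity of the function itself has to be recovered. *)
Lemma Ck1_continuous (R : realType) (n : nat)
    (D : set ('rV[R]_n * 'rV[R]_n)) (f : 'rV[R]_n * 'rV[R]_n -> R) :
  open D -> Ck 1 D (f : _ -> R^o) -> Ck 0 D (f : _ -> R^o).
Proof.
move=> oD fC x Dx; have [C C0 fx] := C1_locally_lipschitz oD fC Dx.
apply/cvgrPdist_lt => e e0.
have xe : \forall y \near x, `|x - y| < e / C.
  by apply/nbhs_normP; exists (e / C) => //=; exact: divr_gt0.
near=> y; rewrite distrC.
have yx : `|f y - f x| <= C * `|y - x| by near: y.
apply: le_lt_trans yx _; rewrite mulrC -ltr_pdivlMr // distrC.
by near: y.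
Unshelve. all: by end_near. Qed.

Lemma Ck2_Ck1 (R : realType) (n : nat)
    (D : set ('rV[R]_n * 'rV[R]_n)) (f : 'rV[R]_n * 'rV[R]_n -> R) :
  open D -> Ck 2 D (f : _ -> R^o) -> Ck 1 D (f : _ -> R^o).
Proof.
move=> oD fC u; have [df dfC] := fC u; split => //.
exact: (Ck1_continuous oD dfC).
Qed.

Lemma finite_common_radius (R : realType) (I : finType) (P : I -> R -> Prop) :
  (forall i, exists2 r : R, 0 < r & P i r) ->
  (forall i (r s : R), 0 < s -> s <= r -> P i r -> P i s) ->
  exists2 r : R, 0 < r & forall i, P i r.
Proof.
move=> Pr Pmono; have [r rP] : exists r : I -> R, forall i, 0 < r i /\ P i (r i).
  have ex i : exists s, 0 < s /\ P i s by have [s] := Pr i; exists s.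
  by have [r] := choice ex; exists r.
have r0 : 0 < \big[Num.min/1]_i r i.
  by apply/bigmin_gtP; split=> [|i _]; [exact: ltr01|have [] := rP i].
exists (\big[Num.min/1]_i r i) => // i; apply: Pmono (proj2 (rP i)) => //.
exact: bigmin_le.
Qed.

(** The form of the definition of a derivative that suits a function whose values
along the line are only known through the solutions of an equation. *)
Lemma derive_of_bound (R : realType) (V : normedModType R) (g : V -> R)
    (x u : V) (l : R) :
  (forall e : R, 0 < e ->
     \forall s \near (0 : R), `|g (x + s *: u) - g x - s * l| <= e * `|s|) ->
  'D_u (g : V -> R^o) x = l.
Proof.
move=> gl; apply/cvg_lim => //; apply/cvgrPdist_le => e e0.
near=> s; have s0 : s != 0 by near: s; exact: nbhs_dnbhs_neq.
have /= gs : `|g (x + s *: u) - g x - s * l| <= e * `|s|.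
  by near: s; apply: nbhs_dnbhs; exact: gl.
rewrite distrC [s *: u + x]addrC.
have -> : s^-1 *: (g (x + s *: u) - g x : R^o) - l
    = s^-1 * (g (x + s *: u) - g x - s * l).
  by rewrite mulrBr mulKf.
by rewrite normrM normfV mulrC ler_pdivrMr ?normr_gt0.
Unshelve. all: by end_near. Qed.

Lemma C1_strict_differentiable_rV (R : realType) (n m : nat)
    (D : set ('rV[R]_n * 'rV[R]_n)) (F : 'rV[R]_n * 'rV[R]_n -> 'rV[R]_m)
    (x : 'rV[R]_n * 'rV[R]_n) :
  open D -> (forall l, Ck 1 D ((fun y => F y 0 l) : _ -> R^o)) -> D x ->
  forall e : R, 0 < e -> exists2 r : R, 0 < r & forall y z,
    `|y - x| < r -> `|z - x| < r ->
    `|F z - F y - \row_l coord_diff (fun y => F y 0 l) x (z - y)|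
      <= e * `|z - y|.
Proof.
move=> oD FC Dx e e0.
have [|r r0 rP] := finite_common_radius
  (fun l => C1_strict_differentiable oD (FC l) Dx e0).
  move=> l r s s0 sr rP y z ys zs.
  by apply: rP; [exact: lt_le_trans ys sr|exact: lt_le_trans zs sr].
exists r => // y z yr zr.
apply: mx_norm_le => [|i l]; first by rewrite mulr_ge0 // ltW.
by rewrite !mxE ord1; exact: rP.
Qed.

Lemma C1_locally_lipschitz_rV (R : realType) (n m : nat)
    (D : set ('rV[R]_n * 'rV[R]_n)) (F : 'rV[R]_n * 'rV[R]_n -> 'rV[R]_m)
    (x : 'rV[R]_n * 'rV[R]_n) :
  open D -> (forall l, Ck 1 D ((fun y => F y 0 l) : _ -> R^o)) -> D x ->
  exists2 C : R, 0 < C & \forall y \near x, `|F y - F x| <= C * `|y - x|.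
Proof.
move=> oD FC Dx.
have [C CP] : exists C : 'I_m -> R, forall l, 0 < C l /\
    \forall y \near x, `|F y 0 l - F x 0 l| <= C l * `|y - x|.
  have ex l : exists C, 0 < C /\
      \forall y \near x, `|F y 0 l - F x 0 l| <= C * `|y - x|.
    by have [C] := C1_locally_lipschitz oD (FC l) Dx; exists C.
  by have [C] := choice ex; exists C.
pose S := \sum_l C l.
have S0 : 0 <= S by apply: sumr_ge0 => l _; apply: ltW; have [] := CP l.
exists (1 + S); first by rewrite ltr_pwDl.
have /filter_forall : forall l, \forall y \near x,
    `|F y 0 l - F x 0 l| <= C l * `|y - x| by move=> l; have [] := CP l.
apply: filterS => y Fy; apply: mx_norm_le => [|i l].
  by rewrite mulr_ge0 // addr_ge0.
rewrite !mxE ord1; apply: le_trans (Fy l) _; apply: ler_wpM2r => //.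
rewrite /S (bigD1 l) //= addrCA lerDl addr_ge0 //.
by apply: sumr_ge0 => k _; apply: ltW; have [] := CP k.
Qed.

(** * Local solvability of equations with invertible derivative *)

(** Completeness of spaces of real matrices, in the form in which the complete
normed module structure, hence the fixed point theorem, applies to them. *)
HB.instance Definition _ (R : realType) (m n : nat) :=
  Complete.copy 'M[R]_(m, n) 'M[R : completeType]_(m, n).

Lemma mulmx_norm_bound (R : realType) (m n : nat) (B : 'M[R]_(m, n)) :
  exists2 C : R, 0 < C & forall x : 'rV[R]_m, `|x *m B| <= C * `|x|.
Proof.
pose S := \sum_k \sum_j `|B k j|.
have S0 : 0 <= S by apply: sumr_ge0 => k _; apply: sumr_ge0.
exists (1 + S); first by rewrite ltr_pwDl.
move=> x; apply: mx_norm_le => [|i j]; first by rewrite mulr_ge0 // addr_ge0.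
rewrite mxE; apply: le_trans (ler_norm_sum _ _ _) _.
rewrite mulrDl mul1r; apply: ler_wpDl => //; rewrite mulr_suml.
apply: ler_sum => k _; rewrite normrM mulrC.
apply: ler_pM => //; last exact: mx_coord_le.
by rewrite (bigD1 j) //= lerDl; apply: sumr_ge0.
Qed.

(** The displacement of the centre by at most rho/2, together with the
contraction factor 1/2, makes the closed ball of radius rho stable. *)
Lemma contraction_fixpoint_ball (R : realType) (V : completeNormedModType R)
    (f : V -> V) (v0 : V) (rho : R) :
  0 <= rho -> `|f v0 - v0| <= rho / 2 ->
  (forall v w, `|v - v0| <= rho -> `|w - v0| <= rho ->
    `|f v - f w| <= 2^-1 * `|v - w|) ->
  exists2 v, `|v - v0| <= rho & f v = v.
Proof.
move=> rho0 fv0 flip; pose U : set V := [set v | `|v0 - v| <= rho].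
have Uv0 : U v0 by rewrite /U /= subrr normr0.
have fU : forall v, U v -> U (f v).
  move=> v; rewrite /U /= [`|v0 - v|]distrC [`|v0 - _|]distrC => vrho.
  apply: le_trans (ler_distD (f v0) _ _) _; rewrite (splitr rho).
  apply: lerD => //; apply: le_trans (flip _ _ vrho _) _.
    by rewrite subrr normr0.
  by rewrite mulrC ler_pM2r.
have half_lt1 : (2^-1 : R) < 1 by rewrite invf_lt1 // ltr1n.
have [|||v Uv fv] := @banach_fixed_point R V U (mkfun_fun fU).
- exists (2^-1)%:nng; split => //= -[v w] /= [vU wU].
  by apply: flip; rewrite distrC.
- exact: closed_closed_ball_.
- by exists v0.
by exists v => //; rewrite distrC.
Qed.

(** The map v |-> v - (M v - p) A^-1 of the simplified Newton method moves two
points apart only by the error made in replacing M by the linear map A. *)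
Lemma newton_step_diff (R : comUnitRingType) (n : nat) (A : 'M[R]_n)
    (v w x y p : 'rV[R]_n) : A \in unitmx ->
  v - (x - p) *m invmx A - (w - (y - p) *m invmx A)
    = - ((x - y - (v - w) *m A) *m invmx A).
Proof.
move=> Au; have -> : x - y = (x - p) - (y - p) by rewrite opprB addrA subrK.
rewrite [in RHS]mulmxBl mulmxK // [in RHS]mulmxBl.
move: ((x - p) *m _) ((y - p) *m _) => X Y.
by apply/rowP => j; rewrite !mxE; ring.
Qed.

(** A parametrised open mapping theorem of Lyusternik-Graves type.  The simplified
Newton map v |-> v - (M q v - p) A^-1 is a contraction of factor 1/2 near [v0],
because M q has strict derivative A; it is applied on the ball whose radius is
K times the initial defect |p - M q v0|, so that the solution comes with a
Lipschitz bound in terms of that defect. *)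
Lemma local_solvability (R : realType) (n : nat) (T : topologicalType)
    (M : T -> 'rV[R]_n -> 'rV[R]_n) (A : 'M[R]_n) (q0 : T) (v0 : 'rV[R]_n) :
  A \in unitmx ->
  (forall e : R, 0 < e -> exists2 r : R, 0 < r & \forall q \near q0,
    forall v w, `|v - v0| < r -> `|w - v0| < r ->
      `|M q v - M q w - (v - w) *m A| <= e * `|v - w|) ->
  {for q0, continuous (M ^~ v0)} ->
  exists2 K : R, 0 < K & \forall q \near q0 & p \near M q0 v0,
    exists2 v, M q v = p & `|v - v0| <= K * `|p - M q v0|.
Proof.
move=> Au Mstrict Mcont.
have [C C0 CP] := mulmx_norm_bound (invmx A).
have [r r0 rP] := Mstrict ((2 * C)^-1) ltac:(by rewrite invr_gt0 mulr_gt0).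
exists (2 * C); first by rewrite mulr_gt0.
(* If M q0 v0 is within d of both M q v0 and p, the defect is less than
   r / (2 C), so the ball on which the Newton map acts lies within radius r. *)
pose d := r / (2 * C) / 2.
have d0 : 0 < d by rewrite !divr_gt0 // mulr_gt0.
have near_q : \forall q \near q0,
    (forall v w, `|v - v0| < r -> `|w - v0| < r ->
      `|M q v - M q w - (v - w) *m A| <= (2 * C)^-1 * `|v - w|) /\
    `|M q0 v0 - M q v0| < d.
  apply/near_andP; split => //.
  by move: Mcont => /cvgrPdist_lt /(_ d d0).
have near_p : \forall p \near M q0 v0, `|M q0 v0 - p| < d.
  by apply/nbhs_normP; exists d.
exists ([set q | (forall v w, `|v - v0| < r -> `|w - v0| < r ->
      `|M q v - M q w - (v - w) *m A| <= (2 * C)^-1 * `|v - w|) /\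
    `|M q0 v0 - M q v0| < d], [set p | `|M q0 v0 - p| < d]) => //=.
move=> -[q p] /= [[qP qd] pd].
pose rho := 2 * C * `|p - M q v0|.
have C20 : 0 < 2 * C by rewrite mulr_gt0.
have rho_r : rho < r.
  rewrite /rho mulrC -ltr_pdivlMr // (splitr (r / _)).
  by apply: le_lt_trans (ler_distD (M q0 v0) _ _) _; rewrite distrC ltrD.
have rho0 : 0 <= rho by rewrite mulr_ge0 // ltW.
pose f v := v - (M q v - p) *m invmx A.
have [||v vrho fv] := @contraction_fixpoint_ball R 'rV[R]_n f v0 rho rho0.
- rewrite /f addrAC subrr add0r normrN; apply: le_trans (CP _) _.
  rewrite distrC /rho; lra.
- move=> v w vr wr.
  have -> : f v - f w = - ((M q v - M q w - (v - w) *m A) *m invmx A).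
    exact: newton_step_diff.
  rewrite normrN; apply: le_trans (CP _) _.
  have := qP v w (le_lt_trans vr rho_r) (le_lt_trans wr rho_r).
  move=> /(ler_wpM2l (ltW C0)) /le_trans; apply.
  by rewrite mulrA invfM mulrCA divff ?mulr1 // gt_eqF.
exists v => //; move/eqP: fv.
rewrite /f -subr_eq0 addrAC subrr add0r oppr_eq0 => /eqP.
move=> /(congr1 (mulmx^~ A)); rewrite mulmxKV // mul0mx => /eqP.
by rewrite subr_eq0 => /eqP.
Qed.

(** * The Legendre transform and the Hamiltonian in coordinates *)

(** The momentum dL/dv of a Lagrangian read in a chart. *)
Definition fiber_deriv (R : realType) (n : nat)
    (f : 'rV[R]_n * 'rV[R]_n -> R) (y : 'rV[R]_n * 'rV[R]_n) : 'rV[R]_n :=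
  \row_k partial2 k f y.

Lemma fiber_derivE (R : realType) (n : nat)
    (f : 'rV[R]_n * 'rV[R]_n -> R) (l : 'I_n) :
  (fun y => fiber_deriv f y 0 l) = partial2 l f.
Proof. by apply/funext => y; rewrite mxE. Qed.

(** [f] is a Lagrangian in coordinates, over the range [U] of a chart. *)
Section legendre_transform.
Variables (R : realType) (n : nat) (U : set 'rV[R]_n).
Variable f : 'rV[R]_n * 'rV[R]_n -> R.
Hypothesis oU : open U.
Hypothesis fC2 : Ck 2 (U `*` setT) (f : _ -> R^o).
Hypothesis fdet : forall q v, U q ->
  \det (\matrix_(k, l) partial2 k (partial2 l f) (q, v)) != 0.

Let D : set ('rV[R]_n * 'rV[R]_n) := U `*` setT.

Lemma open_phase : open D.
Proof.
rewrite openE => -[q v] [/= Uq _]; exists (U, setT) => //; split => /=.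
  exact: open_nbhs_nbhs.
exact: filterT.
Qed.

Lemma fiber_deriv_C1 l : Ck 1 D ((fun y => fiber_deriv f y 0 l) : _ -> R^o).
Proof.
rewrite fiber_derivE; by have [] := fC2 (0, ebase R l).
Qed.

Lemma fiber_deriv_continuous (x : 'rV[R]_n * 'rV[R]_n) : D x ->
  {for x, continuous (fiber_deriv f)}.
Proof.
move=> Dx; apply/cvgrPdist_lt => e e0.
have [C C0 fx] := C1_locally_lipschitz_rV open_phase fiber_deriv_C1 Dx.
have xe : \forall y \near x, `|x - y| < e / C.
  by apply/nbhs_normP; exists (e / C) => //=; exact: divr_gt0.
near=> y; rewrite distrC.
have yx : `|fiber_deriv f y - fiber_deriv f x| <= C * `|y - x| by near: y.
apply: le_lt_trans yx _; rewrite mulrC -ltr_pdivlMr // distrC.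
by near: y.
Unshelve. all: by end_near. Qed.

Lemma legendre_solvable (q0 v0 : 'rV[R]_n) : U q0 ->
  exists2 K : R, 0 < K &
    \forall q \near q0 & p \near fiber_deriv f (q0, v0),
      exists2 v, fiber_deriv f (q, v) = p
        & `|v - v0| <= K * `|p - fiber_deriv f (q, v0)|.
Proof.
move=> Uq0; have Dx : D (q0, v0) by [].
apply: (@local_solvability R n _ (fun q v => fiber_deriv f (q, v))
  (\matrix_(k, l) partial2 k (partial2 l f) (q0, v0)) q0 v0).
- by rewrite unitmxE unitfE; exact: fdet.
- move=> e e0.
  have [r r0 rP] := C1_strict_differentiable_rV open_phase fiber_deriv_C1 Dx e0.
  exists r => //; apply/nbhs_normP; exists r => //= q.
  rewrite /ball_ /= distrC => qr v w vr wr.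
  have := rP (q, w) (q, v).
  have -> : (q, v) - (q, w) = (0, v - w) by congr pair; rewrite /= subrr.
  have -> : `|(0, v - w) : 'rV[R]_n * 'rV[R]_n| = `|v - w|.
    by rewrite [LHS]/Num.Def.normr /= /ProdNormedZmodule.norm /= normr0 max_r.
  rewrite !pair_norm_lt /= qr vr wr => /(_ isT isT).
  congr (`|_ - _| <= _); apply/rowP => l; rewrite [LHS]mxE [RHS]mxE.
  rewrite fiber_derivE /coord_diff /=.
  rewrite [X in X + _]big1 => [|k _]; last by rewrite mxE mul0r.
  by rewrite add0r; apply: eq_bigr => k _; rewrite [in RHS]mxE.
- have fc := fiber_deriv_continuous Dx.
  apply: (@continuous_comp _ _ _ (fun q => (q, v0)) (fiber_deriv f) q0 _ fc).
  rewrite /prop_for /continuous_at.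
  have := @cvg_pair _ _ _ (nbhs q0) (nbhs q0) (nbhs v0) _ _ _ id (cst v0).
  by apply; [exact: cvg_id|exact: cvg_cst].
Qed.

(** The solution v provided by [legendre_solvable] is close to [v0], hence stays
in the prescribed open set. *)
Lemma legendre_open (O : set ('rV[R]_n * 'rV[R]_n)) : open O ->
  open [set z | exists y, [/\ U y.1, O y & z = (y.1, fiber_deriv f y)]].
Proof.
move=> oO; rewrite openE => _ [[q0 v0] [/= Uq0 Oqv ->]].
have Dx : D (q0, v0) by [].
have [K K0 sol] := legendre_solvable v0 Uq0.
have : nbhs (q0, v0) O by apply: open_nbhs_nbhs.
move=> /nbhs_normP [r /= r0 rO].
pose d := r / K / 2.
have d0 : 0 < d by rewrite !divr_gt0.
have fc : \forall q \near q0,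
    `|fiber_deriv f (q0, v0) - fiber_deriv f (q, v0)| < d.
  have /cvgrPdist_lt := fiber_deriv_continuous Dx.
  move=> /(_ d d0) /nbhs_normP [s s0 sP]; apply/nbhs_normP; exists s => // q qs.
  apply: sP; rewrite /ball_ /= in qs *.
  by rewrite pair_norm_lt /= qs subrr normr0.
have qr : \forall q \near q0, `|q0 - q| < r by apply/nbhs_normP; exists r.
have qU : \forall q \near q0, U q by apply: open_nbhs_nbhs.
have pd : \forall p \near fiber_deriv f (q0, v0),
    `|fiber_deriv f (q0, v0) - p| < d by apply/nbhs_normP; exists d.
have pair_near A B : nbhs q0 A -> nbhs (fiber_deriv f (q0, v0)) B ->
    nbhs (q0, fiber_deriv f (q0, v0)) (A `*` B) by move=> ? ?; exists (A, B).
have znear : nbhs (q0, fiber_deriv f (q0, v0))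
    ([set q | U q /\ `|q0 - q| < r /\
       `|fiber_deriv f (q0, v0) - fiber_deriv f (q, v0)| < d]
     `*` [set p | `|fiber_deriv f (q0, v0) - p| < d]).
  by apply: pair_near => //; apply: filterI => //; exact: filterI.
apply: filterS (filterI sol znear) => -[q p] /=.
move=> [[v Mv vK] [[Uq [qq0 Mq]] pp0]].
exists (q, v); split => //=; last by rewrite Mv.
apply: rO; rewrite /ball_ /= pair_norm_lt /= qq0 /= distrC.
apply: le_lt_trans vK _; rewrite mulrC -ltr_pdivlMr // (splitr (r / K)).
apply: le_lt_trans (ler_distD (fiber_deriv f (q0, v0)) _ _) _.
by rewrite distrC ltrD.
Qed.

Variable h : 'rV[R]_n * 'rV[R]_n -> R.
Hypothesis hE : forall q v, U q ->
  h (q, fiber_deriv f (q, v))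
    = \sum_k fiber_deriv f (q, v) 0 k * v 0 k - f (q, v).

(** With (q, p) = (q0, p0) + s (a, b) and v the solution of dL/dv (q, v) = p, the
identity p0 = dL/dv (q0, v0) gives
  h(q, p) - h(q0, p0) - s (b.v0 - a.dL/dq)
    = s b.(v - v0) - (f(q, v) - f(q0, v0) - df (q - q0, v - v0)).
Since |v - v0| = O(|s|), both terms on the right are o(s). *)
Lemma hamiltonian_derive (q0 v0 a b : 'rV[R]_n) : U q0 ->
  'D_(a, b) (h : _ -> R^o) (q0, fiber_deriv f (q0, v0))
    = \sum_k b 0 k * v0 0 k - \sum_k a 0 k * partial1 k f (q0, v0).
Proof.
move=> Uq0; have Dx : D (q0, v0) by [].
set p0 := fiber_deriv f (q0, v0).
have [K K0 sol] := legendre_solvable v0 Uq0.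
have [C C0 Mlip] := C1_locally_lipschitz_rV open_phase fiber_deriv_C1 Dx.
have line_cvg (c u : 'rV[R]_n) : (c + s *: u) @[s --> (0 : R)] --> c.
  rewrite -[X in _ --> X]addr0 -[X in _ --> _ + X](scale0r u).
  by apply: cvgD; [exact: cvg_cst|apply: cvgZr_tmp; exact: cvg_id].
have line_cvg2 (c d u w : 'rV[R]_n) :
    (c + s *: u, d + s *: w) @[s --> (0 : R)] --> (c, d).
  exact: (@cvg_pair _ _ _ (nbhs (0 : R)) (nbhs c) (nbhs d) _ _ _
    (fun s => c + s *: u) (fun s => d + s *: w) (line_cvg c u) (line_cvg d w)).
(* Along the line, the defect |p - M(q, v0)| that controls |v - v0| is at most
   (|b| + C |a|) |s|. *)
pose K1 := K * (`|b| + C * `|a|).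
have K10 : 0 <= K1 by rewrite mulr_ge0 ?addr_ge0 ?mulr_ge0 // ltW.
have sol_line : \forall s \near (0 : R), U (q0 + s *: a) /\ exists2 v,
    fiber_deriv f (q0 + s *: a, v) = p0 + s *: b & `|v - v0| <= K1 * `|s|.
  have sol0 : \forall s \near (0 : R), exists2 v,
      fiber_deriv f (q0 + s *: a, v) = p0 + s *: b
      & `|v - v0| <= K * `|p0 + s *: b - fiber_deriv f (q0 + s *: a, v0)|.
    exact: (line_cvg2 q0 p0 a b _ sol).
  have Mlip0 : \forall s \near (0 : R),
      `|fiber_deriv f (q0 + s *: a, v0) - p0| <= C * (`|s| * `|a|).
    have line_lip : \forall s \near (0 : R),
        `|fiber_deriv f (q0 + s *: a, v0 + s *: 0) - p0|
          <= C * `|(q0 + s *: a, v0 + s *: 0) - (q0, v0)|.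
      exact: (line_cvg2 q0 v0 a 0 _ Mlip).
    apply: filterS line_lip => s.
    rewrite scaler0 addr0 => lip; apply: le_trans lip _.
    rewrite ler_pM2l // pair_norm_le /= subrr normr0 addrAC subrr add0r.
    by rewrite normrZ lexx mulr_ge0.
  have sU : \forall s \near (0 : R), U (q0 + s *: a).
    by apply: (line_cvg q0 a); apply: open_nbhs_nbhs.
  near=> s; split; first by near: s.
  have [v Mv vK] : exists2 v,
      fiber_deriv f (q0 + s *: a, v) = p0 + s *: b
      & `|v - v0| <= K * `|p0 + s *: b - fiber_deriv f (q0 + s *: a, v0)|.
    by near: s.
  exists v => //; apply: le_trans vK _; rewrite /K1 -mulrA ler_pM2l //.
  rewrite addrAC; apply: le_trans (ler_normD _ _) _.
  rewrite mulrDl [X in X <= _]addrC; apply: lerD.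
    by rewrite normrZ mulrC.
  by rewrite distrC -mulrA [`|a| * _]mulrC; near: s.
(* [N] bounds the growth of (q, v) along the line; [e] is split evenly between
   the two terms of the remainder. *)
pose N := 1 + (`|a| + K1).
have N0 : 0 < N by rewrite ltr_pwDl // addr_ge0.
have aN : `|a| <= N by rewrite /N addrCA lerDl addr_ge0.
have K1N : K1 <= N by rewrite /N addrA lerDr addr_ge0.
pose B := \sum_k `|b 0 k|.
have B0 : 0 <= B by apply: sumr_ge0.
apply: derive_of_bound => e e0.
have eN0 : 0 < e / 2 / N by rewrite !divr_gt0.
have [r r0 rP] :=
  C1_strict_differentiable open_phase (Ck2_Ck1 open_phase fC2) Dx eN0.
have BK0 : 0 < 1 + B * K1 by rewrite ltr_pwDl // mulr_ge0.
have s_small (d : R) : 0 < d -> \forall s \near (0 : R), `|s| < d.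
  move=> d0; apply/nbhs_normP; exists d => //= s.
  by rewrite /ball_ /= sub0r normrN.
near=> s.
have [Us [v Mv vK]] : U (q0 + s *: a) /\ exists2 v,
    fiber_deriv f (q0 + s *: a, v) = p0 + s *: b & `|v - v0| <= K1 * `|s|.
  by near: s.
have srN : `|s| < r / N by near: s; apply: s_small; exact: divr_gt0.
have seB : `|s| < e / 2 / (1 + B * K1).
  by near: s; apply: s_small; rewrite !divr_gt0.
have xN : `|(q0 + s *: a, v) - (q0, v0)| <= N * `|s|.
  rewrite pair_norm_le /= addrAC subrr add0r normrZ mulrC.
  apply/andP; split; first by apply: ler_wpM2r.
  by apply: le_trans vK _; apply: ler_wpM2r.
have fbound := rP (q0, v0) (q0 + s *: a, v).
have {}fbound : `|f (q0 + s *: a, v) - f (q0, v0) -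
    coord_diff f (q0, v0) ((q0 + s *: a, v) - (q0, v0))| <= e / 2 * `|s|.
  apply: le_trans (fbound _ _) _.
  - by rewrite subrr normr0.
  - by apply: le_lt_trans xN _; rewrite mulrC -ltr_pdivlMr.
  - by rewrite -mulrA ler_pM2l ?divr_gt0 // ler_pdivrMl.
rewrite [(q0, _) + _](_ : _ = (q0 + s *: a, p0 + s *: b)) //.
rewrite -Mv hE // hE // Mv -/p0.
have diffE : coord_diff f (q0, v0) ((q0 + s *: a, v) - (q0, v0))
    = s * (\sum_k a 0 k * partial1 k f (q0, v0))
      + (\sum_k p0 0 k * v 0 k - \sum_k p0 0 k * v0 0 k).
  rewrite /coord_diff mulr_sumr -sumrB; congr (_ + _); apply: eq_bigr => k _ /=.
    by rewrite !mxE; ring.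
  by rewrite !mxE; ring.
have pvE : \sum_k (p0 + s *: b) 0 k * v 0 k
    = \sum_k p0 0 k * v 0 k + s * \sum_k b 0 k * v 0 k.
  rewrite mulr_sumr -big_split; apply: eq_bigr => k _ /=.
  by rewrite !mxE; ring.
have bvE : \sum_k b 0 k * (v - v0) 0 k
    = \sum_k b 0 k * v 0 k - \sum_k b 0 k * v0 0 k.
  by rewrite -sumrB; apply: eq_bigr => k _; rewrite !mxE mulrBr.
have bvbound : `|s * \sum_k b 0 k * (v - v0) 0 k| <= e / 2 * `|s|.
  rewrite normrM mulrC; apply: ler_wpM2r => //.
  apply: (@le_trans _ _ (B * (K1 * `|s|))).
    apply: le_trans (ler_norm_sum _ _ _) _; rewrite /B mulr_suml.
    apply: ler_sum => k _; rewrite normrM; apply: ler_wpM2l => //.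
    exact: le_trans (mx_coord_le _ _ _) vK.
  rewrite mulrA; apply: le_trans (_ : (1 + B * K1) * `|s| <= _).
    by apply: ler_wpM2r => //; rewrite lerDr.
  by rewrite mulrC -ler_pdivlMr // ltW.
rewrite (splitr e) mulrDl; apply: le_trans (lerD bvbound fbound).
apply: le_trans (ler_normB _ _); rewrite pvE diffE bvE.
by rewrite le_eqVlt; apply/orP; left; apply/eqP; congr `|_|; ring.
Unshelve. all: by end_near. Qed.

Lemma hamiltonian_partial2 (q v : 'rV[R]_n) k : U q ->
  partial2 k h (q, fiber_deriv f (q, v)) = v 0 k.
Proof.
move=> Uq; rewrite [LHS]hamiltonian_derive // [X in _ - X]big1 ?subr0.
  rewrite (bigD1 k) //= big1 ?addr0 => [|l lk]; first by rewrite mxE !eqxx mul1r.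
  by rewrite mxE eqxx (negbTE lk) mul0r.
by move=> l _; rewrite mxE mul0r.
Qed.

Lemma hamiltonian_partial1 (q v : 'rV[R]_n) k : U q ->
  partial1 k h (q, fiber_deriv f (q, v)) = - partial1 k f (q, v).
Proof.
move=> Uq; rewrite [LHS]hamiltonian_derive // [X in X - _]big1 ?sub0r.
  rewrite (bigD1 k) //= big1 ?addr0 => [|l lk]; first by rewrite mxE !eqxx mul1r.
  by rewrite mxE eqxx (negbTE lk) mul0r.
by move=> l _; rewrite mxE mul0r.
Qed.

(** Injectivity is forced by the existence of [h]: the velocity is the derivative
of [h] with respect to p, which depends on (q, p) only. *)
Lemma fiber_deriv_inj (q v w : 'rV[R]_n) : U q ->
  fiber_deriv f (q, v) = fiber_deriv f (q, w) -> v = w.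
Proof.
move=> Uq Mvw; apply/rowP => k.
by rewrite -(hamiltonian_partial2 v k Uq) Mvw hamiltonian_partial2.
Qed.

End legendre_transform.

(** * Processes related by the Legendre transform *)

(** The exceptional null sets of almost sure relations between processes disappear
here, by completeness of the filtration. *)
Lemma filt_ae_eq (R : realType) (d : measure_display)
    (Omega : measurableType d) (P : probability Omega R) (a b : R)
    (F : filtration P a b) (s : R) (A B : set Omega) (G : Omega -> Prop) :
  a <= s <= b -> (\forall w \ae P, G w) -> F s B ->
  (forall w, G w -> (A w <-> B w)) -> F s A.
Proof.
move=> sab aeG FB AB; pose N := [set w | ~ G w].
have Nnull : P.-negligible N by exact: aeG.
have FN (C : set Omega) : C `<=` N -> F s C.
  by move=> CN; apply: (filt_complete F sab); exact: negligibleS CN Nnull.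
have -> : A = (B `\` N) `|` (A `&` N).
  apply/seteqP; split => w.
    move=> Aw; have [Gw|Nw] := pselect (G w); last by right.
    by left; split; [apply/(AB w Gw)|move=> Nw; exact: Nw].
  by move=> [[Bw /contrapT Gw]|[]//]; apply/(AB w Gw).
rewrite -(sigma_algebra_id (filt_sigma F sab)) in FB FN *.
apply: (@measurableU _ (g_sigma_algebraType (F s))).
  by apply: (@measurableD _ (g_sigma_algebraType (F s))) => //; exact: FN.
by apply: FN; exact: subIsetr.
Qed.

Definition momentum_image (R : realType) (n : nat) (Q : manifold R n)
    (L : tangent Q -> R) (i : chart Q) (O : set ('rV[R]_n * 'rV[R]_n)) :
  set ('rV[R]_n * 'rV[R]_n) :=
  [set z | exists y, [/\ cran i y.1, O y & z = (y.1, momentum L i y)]].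

Section lagrangian_manifold.
Variables (R : realType) (n : nat) (Q : manifold R n).
Variables (L : tangent Q -> R) (H : cotangent Q -> R).
Hypothesis LC2 : C2_lagrangian L.
Hypothesis Lreg : hyperregular L.
Hypothesis LH : is_hamiltonian L H.

Let hE (i : chart Q) (q v : 'rV[R]_n) : cran i q ->
  (H \o cpoint i) (q, fiber_deriv (L \o tpoint i) (q, v))
    = \sum_k fiber_deriv (L \o tpoint i) (q, v) 0 k * v 0 k
      - (L \o tpoint i) (q, v).
Proof. exact: LH. Qed.

Lemma hamilton_eq_velocity (i : chart Q) (y : 'rV[R]_n * 'rV[R]_n) k :
  cran i y.1 ->
  partial2 k (H \o cpoint i) (y.1, momentum L i y) = y.2 0 k.
Proof.
case: y => q v /= Uq.
exact: (hamiltonian_partial2 (@cran_open _ _ Q i) (LC2 i)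
  (Lreg (i := i)) (hE (i := i))).
Qed.

Lemma hamilton_eq_force (i : chart Q) (y : 'rV[R]_n * 'rV[R]_n) k :
  cran i y.1 ->
  partial1 k (H \o cpoint i) (y.1, momentum L i y)
    = - partial1 k (L \o tpoint i) y.
Proof.
case: y => q v /= Uq.
exact: (hamiltonian_partial1 (@cran_open _ _ Q i) (LC2 i)
  (Lreg (i := i)) (hE (i := i))).
Qed.

Lemma momentum_inj (i : chart Q) (y z : 'rV[R]_n * 'rV[R]_n) :
  cran i y.1 -> y.1 = z.1 -> momentum L i y = momentum L i z -> y = z.
Proof.
case: y z => q v [_ w] /= Uq <- Mvw; congr pair.
exact: (fiber_deriv_inj (@cran_open _ _ Q i) (LC2 i)
  (Lreg (i := i)) (hE (i := i)) Uq).
Qed.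

Lemma momentum_open (i : chart Q) (O : set ('rV[R]_n * 'rV[R]_n)) : open O ->
  open (momentum_image L i O).
Proof.
exact: (legendre_open (@cran_open _ _ Q i) (LC2 i) (Lreg (i := i))).
Qed.

Lemma cran_cmap (i : chart Q) (x : Q) : cdom i x -> cran i (cmap i x).
Proof. by exists x. Qed.

Lemma legendre_ccoord (i : chart Q) (x : Q) (v p : 'rV[R]_n) :
  cdom i x -> legendre L x v p ->
  ccoord i (x, p) = ((tcoord i (x, v)).1, momentum L i (tcoord i (x, v))).
Proof. by move=> ix /(_ i ix) <-. Qed.

(** Through injectivity, conditions on the velocity become conditions on the
momentum; this is how the regularity of p is transferred to v. *)
Lemma legendre_coord_image (i : chart Q) (x : Q) (v p : 'rV[R]_n)
    (O : set ('rV[R]_n * 'rV[R]_n)) :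
  cdom i x -> legendre L x v p ->
  O (tcoord i (x, v)) <->
  momentum_image L i O (ccoord i (x, p)).
Proof.
move=> ix lvp; rewrite (legendre_ccoord ix lvp); split.
  by move=> Ov; exists (tcoord i (x, v)); split => //; exact: cran_cmap.
move=> [y [yi Oy ME]]; suff -> : tcoord i (x, v) = y by [].
apply: (@momentum_inj i); first exact: cran_cmap.
  exact: (congr1 fst ME).
exact: (congr1 snd ME).
Qed.

(** The set of momenta that correspond to velocities in an open set is open
([momentum_open]), so both the continuity of paths and the adaptedness of
(q, v) are instances of the same properties of (q, p). *)
Lemma velocity_continuous_adapted (a b : R) (d : measure_display)
    (Omega : measurableType d) (P : probability Omega R) (F : filtration P a b)
    (q : R -> Omega -> Q) (v p : R -> Omega -> 'rV[R]_n) :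
  (\forall w \ae P, forall s, a <= s <= b ->
     legendre L (q s w) (v s w) (p s w)) ->
  continuous_adapted F (@ccoord R n Q) q p ->
  continuous_adapted F (@tcoord R n Q) q v.
Proof.
move=> lvp [qc pc pa]; split; first exact: qc.
  near=> w => i s sab iqs O' nO.
  have lw : forall s, a <= s <= b -> legendre L (q s w) (v s w) (p s w).
    by near: w.
  have qw : {within `[a, b], continuous (fun s => q s w)} by near: w.
  have pw : forall (i : chart Q) s, a <= s <= b -> cdom i (q s w) ->
      (fun u => ccoord i (q u w, p u w)) @ within `[a, b] (nbhs s)
        --> ccoord i (q s w, p s w) by near: w.
  have [V [oV Vs VO']] : exists V : set ('rV[R]_n * 'rV[R]_n),
      [/\ open V, V (tcoord i (q s w, v s w)) & V `<=` O'].
    by move: nO; rewrite nbhsE => -[V [oV Vs] VO']; exists V.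
  have near_u : \forall u \near within `[a, b] (nbhs s), cdom i (q u w).
    have /subspace_continuousP /(_ s) qs := qw.
    apply: qs; first by rewrite /= in_itv.
    by apply: open_nbhs_nbhs; split => //; exact: cdom_open.
  have near_p : \forall u \near within `[a, b] (nbhs s),
      momentum_image L i V (ccoord i (q u w, p u w)).
    apply: (pw i s sab iqs (momentum_image L i V)).
    apply: open_nbhs_nbhs; split; first exact: momentum_open.
    by apply/(legendre_coord_image _ iqs (lw s sab)).
  suff near_V : \forall u \near within `[a, b] (nbhs s),
      V (tcoord i (q u w, v u w)) by exact: filterS VO' near_V.
  near=> u.
  have uab : a <= u <= b.
    have : [set` `[a, b]] u by near: u; exact: withinT.
    by rewrite /= in_itv.
  apply/(legendre_coord_image _ _ (lw u uab)); first by near: u.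
  by near: u.
move=> s sab i O oO.
have FB := pa s sab i _ (@momentum_open i O oO).
refine (@filt_ae_eq R d Omega P a b F s _ _ _ sab lvp FB _) => w lw.
split=> -[iw Ow]; split => //.
  by apply/(legendre_coord_image _ iw (lw s sab)).
by apply/(legendre_coord_image _ iw (lw s sab)).
Unshelve. all: by end_near. Qed.
End lagrangian_manifold.

(** * Replacing drifts, and the equivalence of the two systems *)

Section drift_replacement.
Variables (R : realType) (d : measure_display) (Omega : measurableType d).
Variables (P : probability Omega R) (sigma tau : Omega -> R).
Variables (X mu mu' : R -> Omega -> R).
Hypothesis mu_eq : \forall w \ae P, sigma w < tau w ->
  forall s, sigma w <= s <= tau w -> mu s w = mu' s w.

Let drift_integral_eq (w : Omega) :
  (forall s, sigma w <= s <= tau w -> mu s w = mu' s w) ->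
  lebesgue_measure.-integrable `[sigma w, tau w] (fun s => (mu s w)%:E) ->
  lebesgue_measure.-integrable `[sigma w, tau w] (fun s => (mu' s w)%:E) /\
  (\int[lebesgue_measure]_(s in `[sigma w, tau w]) mu s w)%R
    = (\int[lebesgue_measure]_(s in `[sigma w, tau w]) mu' s w)%R.
Proof.
move=> muw imu; split.
  apply: eq_integrable imu => // s; rewrite inE /= in_itv /= => sw.
  by rewrite muw.
by apply: eq_Rintegral => s; rewrite inE /= in_itv /= => sw; exact: muw.
Qed.

Lemma drift_equation_ext :
  drift_equation P sigma tau X mu -> drift_equation P sigma tau X mu'.
Proof.
apply: filterS2 mu_eq => w muw Xw st; have [imu XE] := Xw st.
by have [imu' intE] := drift_integral_eq (muw st) imu; rewrite -intE.
Qed.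

Lemma ito_equation_ext (a b : R) (F : filtration P a b) (m : nat)
    (W nu : 'I_m -> R -> Omega -> R) :
  ito_equation F W sigma tau X mu nu -> ito_equation F W sigma tau X mu' nu.
Proof.
move=> [J [Jito XJ]]; exists J; split => //.
apply: filterS2 mu_eq XJ => w muw Xw st; have [imu XE] := Xw st.
by have [imu' intE] := drift_integral_eq (muw st) imu; rewrite -intE.
Qed.

End drift_replacement.

(** Stopping times take values in [a, b], so properties that hold throughout
[a, b] are available on the interval together with the chart. *)
Lemma chart_interval_ae (R : realType) (n : nat) (Q : manifold R n) (a b : R)
    (d : measure_display) (Omega : measurableType d) (P : probability Omega R)
    (F : filtration P a b) (q : R -> Omega -> Q) (i : chart Q)
    (sigma tau : Omega -> R) (G : R -> Omega -> Prop) :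
  chart_interval F q i sigma tau ->
  (\forall w \ae P, forall s, a <= s <= b -> G s w) ->
  \forall w \ae P, sigma w < tau w ->
    forall s, sigma w <= s <= tau w -> cdom i (q s w) /\ G s w.
Proof.
move=> [[sab _] [tab _] _ qi] aeG; apply: filterS2 qi aeG => w qw Gw st s sst.
split; first exact: qw.
have /andP[ss st'] := sst; have /andP[as_ _] := sab w; have /andP[_ tb] := tab w.
by apply: Gw; rewrite (le_trans as_ ss) (le_trans st' tb).
Qed.

Theorem proposition3 (R : realType) (n m : nat) (Q : manifold R n)
    (a b alpha beta t : R) (d : measure_display) (Omega : measurableType d)
    (P : probability Omega R) (F : filtration P a b)
    (W : 'I_m -> R -> Omega -> R) (L : tangent Q -> R) (gamma : 'I_m -> Q -> R)
    (H : cotangent Q -> R) :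
  a <= b -> 0 < alpha <= 1 -> 0 < beta <= 1 ->
  C2_lagrangian L -> hyperregular L -> (forall r, C2_fun (gamma r)) ->
  (forall r, wiener F (W r)) -> independent_processes P a b W ->
  is_hamiltonian L H ->
  forall (q : R -> Omega -> Q) (p : R -> Omega -> 'rV[R]_n),
    (exists v : R -> Omega -> 'rV[R]_n,
       lagrangian_system alpha beta t F W L gamma q v p) <->
    hamiltonian_system alpha beta t F W L H gamma q p.
Proof.
move=> _ _ _ LC2 Lreg _ _ _ LH q p.
have velocityE i x v y k : cdom i x -> legendre L x v y ->
    partial2 k (H \o cpoint i) (ccoord i (x, y)) = (tcoord i (x, v)).2 0 k.
  move=> ix lvy; rewrite (legendre_ccoord ix lvy).
  by rewrite (hamilton_eq_velocity LC2 Lreg LH) //; exact: cran_cmap.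
have forceE i x v y k (c : R) : cdom i x -> legendre L x v y ->
    partial1 k (L \o tpoint i) (tcoord i (x, v))
      + partial2 k (L \o tpoint i) (tcoord i (x, v)) * c
    = - partial1 k (H \o cpoint i) (ccoord i (x, y))
      + c * (ccoord i (x, y)).2 0 k.
  move=> ix lvy; rewrite (legendre_ccoord ix lvy).
  rewrite (hamilton_eq_force LC2 Lreg LH); last exact: cran_cmap.
  by rewrite opprK mulrC /= mxE.
split=> [[v [_ pc qeq peq lvp]]|[pc dom qeq peq]].
  split => //.
  - by apply: filterS lvp => w lw s sab; exists (v s w); exact: lw.
  - move=> i sigma tau st k; apply: drift_equation_ext (qeq i sigma tau st k).
    apply: filterS (chart_interval_ae st lvp) => w lw stw s sst.
    by have [ix lx] := lw stw s sst; rewrite (velocityE _ _ _ _ _ ix lx).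
  - move=> i sigma tau st k; apply: ito_equation_ext (peq i sigma tau st k).
    apply: filterS (chart_interval_ae st lvp) => w lw stw s sst.
    by have [ix lx] := lw stw s sst; exact: forceE ix lx.
(* The velocity exists only almost surely; the default 0 stands in elsewhere. *)
pose v s w := xget 0 [set u | legendre L (q s w) u (p s w)].
have lvp : \forall w \ae P, forall s, a <= s <= b ->
    legendre L (q s w) (v s w) (p s w).
  apply: filterS dom => w domw s sab; have [u lu] := domw s sab.
  exact: (@xgetPex _ 0 [set u | legendre L (q s w) u (p s w)]) (ex_intro _ u lu).
exists v; split => //.
- exact: (velocity_continuous_adapted LC2 Lreg LH lvp pc).
- move=> i sigma tau st k; apply: drift_equation_ext (qeq i sigma tau st k).
  apply: filterS (chart_interval_ae st lvp) => w lw stw s sst.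
  by have [ix lx] := lw stw s sst; rewrite (velocityE _ _ _ _ _ ix lx).
- move=> i sigma tau st k; apply: ito_equation_ext (peq i sigma tau st k).
  apply: filterS (chart_interval_ae st lvp) => w lw stw s sst.
  by have [ix lx] := lw stw s sst; rewrite [RHS](forceE _ _ _ _ _ _ ix lx).
Qed.
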